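(* Let $\Bbbk$ be a field and let $G$ be a finite, simple, connected, nontrivial graph with edge ideal $I(G)$. The following are equivalent: (1) the LCM lattice $\mathcal{L}_{I(G)}$ is Boolean; (2) $\mathcal{L}_{I(G)}$ is distributive; (3) $G$ is a star graph.
   Context: A graph is nontrivial if it has at least one edge. For a graph $G$ on vertex set $\{1,\ldots,n\}$, $I(G)=(x_ix_j\mid\{i,j\}\in E(G))\subseteq\Bbbk[x_1,\ldots,x_n]$. A star graph is a graph isomorphic to $\operatorname{St}_n$, with vertex set $\{1,\ldots,n\}$ and edges $\{1,i\}$ for $2\le i\le n$. The LCM lattice $\mathcal{L}_I$ of a monomial ideal $I$ is the set of least common multiples of subsets of its minimal monomial generators (the lcm of the empty set is $1$), ordered by divisibility; it is a finite lattice with join lcm. A lattice is distributive if $x\wedge(y\vee z)=(x\wedge y)\vee(x\wedge z)$ for all $x,y,z$. A bounded lattice is Boolean if it is distributive and every element $x$ has exactly one complement (an element $y$ with $x\wedge y=\hat 0$ and $x\vee y=\hat 1$). *)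

(* Defs.v *)
From HB Require Import structures.
From mathcomp Require Import all_boot all_order all_algebra.
From mathcomp Require Import finmap mpoly.
From mathcomp Require Import boolp classical_sets.

Set Implicit Arguments.
Unset Strict Implicit.
Unset Printing Implicit Defensive.

Import Order.TTheory GRing.Theory.
Local Open Scope ring_scope.
Local Open Scope classical_set_scope.

Section Ideals.

Definition ideal_span (R : comPzRingType) (B : set R) : set R :=
  [set p | exists2 s : seq (R * R),
     (forall c, c \in s -> B c.2) & p = \sum_(c <- s) c.1 * c.2].

Variables (n : nat) (K : fieldType).
Implicit Types (I : set {mpoly K[n]}) (B : set 'X_{1..n}).

Definition monomially_generates I B : Prop :=
  ideal_span [set ('X_[m] : {mpoly K[n]}) | m in B] = I.

Definition minimal_monomial_generating_set I B : Prop :=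
  monomially_generates I B /\
  forall C : set 'X_{1..n}, C `<=` B -> monomially_generates I C -> C = B.

(* A monomial ideal has exactly one minimal monomial generating set, so that
   this union over all of them is that set. *)
Definition minimal_monomial_generators I : set 'X_{1..n} :=
  [set m | exists2 B, minimal_monomial_generating_set I B & B m].

End Ideals.

(* Monomials are identified with their exponent vectors: [0%MM] is the monomial
   1 and [(_ <= _)%MM] is divisibility. *)
Definition monomial_lcm n (S : {fset 'X_{1..n}}) : 'X_{1..n} :=
  \big[@mlcm n/0%MM]_(m <- S) m.

Lemma monomial_lcm_le n (S : {fset 'X_{1..n}}) (m : 'X_{1..n}) :
  reflect (forall s, s \in S -> (s <= m)%MM) (monomial_lcm S <= m)%MM.
Proof.
have -> : (monomial_lcm S <= m)%MM = all (fun s => (s <= m)%MM) S.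
  rewrite /monomial_lcm; elim: (enum_fset S) => [|s r IHr] /=.
    by rewrite big_nil; apply/mnm_lepP => i; rewrite mnm0E.
  by rewrite big_cons lem_mlcm IHr.
exact: allP.
Qed.

Lemma le_monomial_lcm n (S : {fset 'X_{1..n}}) (s : 'X_{1..n}) :
  s \in S -> (s <= monomial_lcm S)%MM.
Proof. exact: (monomial_lcm_le S _ (lepm_refl _)). Qed.

Lemma lepm_anti n : antisymmetric (fun m1 m2 : 'X_{1..n} => (m1 <= m2)%MM).
Proof.
move=> m1 m2 /andP[/mnm_lepP le12 /mnm_lepP le21].
by apply/mnmP => i; apply/eqP; rewrite eqn_leq le12 le21.
Qed.

Fact lcm_display : Order.disp_t. Proof. exact: Order.Disp tt tt. Qed.

Section LcmLattice.

Variables (n : nat) (K : fieldType) (I : set {mpoly K[n]}).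

Definition generator_lcms : set 'X_{1..n} :=
  [set m | exists2 S : {fset 'X_{1..n}},
     (forall s, s \in S -> minimal_monomial_generators I s)
     & m = monomial_lcm S].

Definition lcm_lattice : Type := {m : 'X_{1..n} | `[< generator_lcms m >]}.

HB.instance Definition _ := SubChoice.on lcm_lattice.

Implicit Types x y z : lcm_lattice.

Definition lcm_le x y : bool := (val x <= val y)%MM.

Fact lcm_le_refl : reflexive lcm_le.
Proof. by move=> x; apply: lepm_refl. Qed.

Fact lcm_le_anti : antisymmetric lcm_le.
Proof. by move=> x y /lepm_anti/val_inj. Qed.

Fact lcm_le_trans : transitive lcm_le.
Proof. by move=> y x z; apply: lepm_trans. Qed.

HB.instance Definition _ :=
  Order.Le_isPOrder.Build lcm_display lcm_lattice
    lcm_le_refl lcm_le_anti lcm_le_trans.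

Fact lcm_join_subproof x y :
  `[< generator_lcms (mlcm (val x) (val y)) >].
Proof.
case: x y => [_ /= /asboolP[S IS ->]] [_ /= /asboolP[T IT ->]].
apply/asboolP; exists (S `|` T)%fset.
  by move=> s; rewrite inE => /orP[/IS|/IT].
apply: lepm_anti; rewrite lem_mlcm -andbA; apply/and3P; split.
- by apply/monomial_lcm_le => s sS; apply: le_monomial_lcm; rewrite inE sS.
- by apply/monomial_lcm_le => s sT; apply: le_monomial_lcm; rewrite inE sT orbT.
- apply/monomial_lcm_le => s; rewrite inE => /orP[sS|sT].
    exact: lepm_trans (le_monomial_lcm sS) (lem_mlcml _ _).
  exact: lepm_trans (le_monomial_lcm sT) (lem_mlcmr _ _).
Qed.

Definition lcm_join x y : lcm_lattice :=
  exist (fun m => `[< generator_lcms m >]) _ (lcm_join_subproof x y).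

Definition common_generators x y : {fset 'X_{1..n}} :=
  [fset m in [seq bmnm b | b : 'X_{1..n < (mdeg (val x)).+1}] |
    [&& `[< minimal_monomial_generators I m >], (m <= val x)%MM
      & (m <= val y)%MM]]%fset.

Fact common_generatorsP x y m :
  m \in common_generators x y <->
  [/\ minimal_monomial_generators I m, (m <= val x)%MM & (m <= val y)%MM].
Proof.
rewrite !inE /=; split=> [/andP[_ /and3P[/asboolP ? ? ?]] //|[Im lemx lemy]].
rewrite lemx lemy !andbT; apply/andP; split; last exact/asboolP.
have ltm : (mdeg m < (mdeg (val x)).+1)%N.
  move: (congr1 (@mdeg n) (submK lemx)); rewrite mdegD ltnS => <-.
  exact: leq_addl.
by apply/mapP; exists (BMultinom ltm); rewrite // mem_enum.
Qed.

Fact lcm_meet_subproof x y :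
  `[< generator_lcms (monomial_lcm (common_generators x y)) >].
Proof.
apply/asboolP; exists (common_generators x y) => // s.
by case/common_generatorsP.
Qed.

(* The meet of the lcm lattice is in general a proper divisor of the gcd. *)
Definition lcm_meet x y : lcm_lattice :=
  exist (fun m => `[< generator_lcms m >]) _ (lcm_meet_subproof x y).

Fact lcm_meetP x y z : (x <= lcm_meet y z)%O = (x <= y)%O && (x <= z)%O.
Proof.
apply/idP/andP => [le_x_yz|[]].
  by split; apply: lepm_trans le_x_yz _; apply/monomial_lcm_le => s
    /common_generatorsP[].
have /asboolP[S IS defx] := valP x.
rewrite /Order.le /= /lcm_le defx => lexy lexz.
apply/monomial_lcm_le => s sS; apply/le_monomial_lcm/common_generatorsP.
have lesx := le_monomial_lcm sS.
by split; [exact: IS | exact: lepm_trans lexy | exact: lepm_trans lexz].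
Qed.

Fact lcm_joinP x y z : (lcm_join x y <= z)%O = (x <= z)%O && (y <= z)%O.
Proof. exact: lem_mlcm. Qed.

HB.instance Definition _ :=
  Order.POrder_MeetJoin_isLattice.Build lcm_display lcm_lattice
    lcm_meetP lcm_joinP.

End LcmLattice.

Definition distributive_lattice d (L : latticeType d) : Prop :=
  forall x y z : L, (x `&` (y `|` z) = (x `&` y) `|` (x `&` z))%O.

(* The lattice is not assumed to be bounded: having a least element [b] and a
   greatest element [t] is part of the definition. *)
Definition boolean_lattice d (L : latticeType d) : Prop :=
  exists b t : L,
    [/\ forall x : L, (b <= x <= t)%O,
        distributive_lattice L
      & forall x : L, exists! y : L, (x `&` y = b)%O /\ (x `|` y = t)%O].

Definition edge_ideal (K : fieldType) n (G : rel 'I_n) : set {mpoly K[n]} :=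
  ideal_span [set p | exists i j, G i j /\ p = 'X_i * 'X_j].

Arguments edge_ideal K {n} G.

Definition nontrivial_graph (T : finType) (G : rel T) : Prop :=
  exists x y, G x y.

Definition connected_graph (T : finType) (G : rel T) : Prop :=
  forall x y, connect G x y.

Definition graph_isomorphic (T U : finType) (G : rel T) (H : rel U) : Prop :=
  exists2 f : T -> U, bijective f & forall x y, H (f x) (f y) = G x y.

(* The center of the star is the vertex of value 0. *)
Definition star n : rel 'I_n :=
  fun i j => (val i == 0%N) (+) (val j == 0%N).

Definition star_graph (T : finType) (G : rel T) : Prop :=
  exists n, graph_isomorphic G (@star n).

(* Main.v *)
Require Import Defs.
From mathcomp Require Import all_boot all_order all_algebra.
From mathcomp Require Import finmap mpoly boolp classical_sets.
From mathcomp Require Import perm.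

(** Both directions go through the atoms of the lcm lattice, the monomials
    [x_i x_j] of the edges.  In a distributive lattice no atom lies below the
    join of two other atoms, so every edge has an end of degree one, and a
    connected graph with this property is a star.  Conversely, sending a
    monomial to the set of leaves whose edge divides it identifies the lcm
    lattice of a star with the powerset of its leaves. *)

Set Implicit Arguments.
Unset Strict Implicit.
Unset Printing Implicit Defensive.

Import Order.TTheory GRing.Theory.
Local Open Scope ring_scope.

(** * Minimal monomial generators of an edge ideal *)

Lemma ideal_span_le (R : comPzRingType) (A B : set R) :
  (forall a, A a -> B a) -> forall p, ideal_span A p -> ideal_span B p.
Proof. by move=> AB p [s sA ->]; exists s => // c /sA/AB. Qed.

Lemma mem_ideal_span (R : comPzRingType) (B : set R) b :
  B b -> ideal_span B b.
Proof.
move=> Bb; exists [:: (1, b)]; first by move=> c; rewrite inE => /eqP ->.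
by rewrite big_seq1 mul1r.
Qed.

(** In a combination equal to ['X_[K, m]], some summand has a nonzero coefficient at [m], and the
    support of a multiple of ['X_[K, b]] consists of multiples of [b]. *)
Lemma mpolyX_ideal_span n (K : fieldType) (B : set 'X_{1..n})
    (m : 'X_{1..n}) :
  ideal_span (image B (fun b => 'X_[K, b])) 'X_[K, m] ->
  exists2 b, B b & (b <= m)%MM.
Proof.
case=> s sB /(congr1 (mcoeff m)); rewrite mcoeffX eqxx raddf_sum /= => sum1.
have [c cs nzc] : exists2 c, c \in s & (c.1 * c.2)@_m != 0.
  apply/hasP; apply/negPn/negP => /hasPn zs.
  move/eqP: sum1; rewrite big_seq big1 ?oner_eq0 // => c /zs.
  by rewrite negbK => /eqP.
have [b Bb eqb] := sB c cs; exists b => //.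
move: nzc; rewrite -eqb -mcoeff_msupp (perm_mem (msuppMX _ _)).
by case/mapP => m' _ ->; exact: lem_addr.
Qed.

Definition edge_monomials n (G : rel 'I_n) : set 'X_{1..n} :=
  fun m => exists i j, G i j /\ m = (U_(i) + U_(j))%MM.

(** Both monomials have degree two, so their quotient has degree zero. *)
Lemma edge_monomials_le n (G : rel 'I_n) m m' :
  edge_monomials G m -> edge_monomials G m' -> (m <= m')%MM -> m = m'.
Proof.
move=> [i [j [_ ->]]] [k [l [_ ->]]] le; move: (submK le) => eq_m.
move/(congr1 (@mdeg n)): (eq_m); rewrite !mdegD !mdeg1.
move/eqP; rewrite -[X in _ == X]add0n eqn_add2r mdeg_eq0 => /eqP d0.
by rewrite -eq_m d0 add0m.
Qed.

Lemma edge_monomials_generate (K : fieldType) n (G : rel 'I_n) :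
  monomially_generates (edge_ideal K G) (edge_monomials G).
Proof.
apply/seteqP; split; apply: ideal_span_le => p.
  by case=> _ [i [j [Gij ->]]] <-; exists i, j; rewrite mpolyXD.
case=> i [j [Gij ->]]; exists (U_(i) + U_(j))%MM; last by rewrite mpolyXD.
by exists i, j.
Qed.

Lemma minimal_monomial_generators_edge_ideal (K : fieldType) n (G : rel 'I_n) :
  minimal_monomial_generators (edge_ideal K G) = edge_monomials G.
Proof.
have genE := edge_monomials_generate K G.
have dvdE B C m : monomially_generates (edge_ideal K G) B ->
    monomially_generates (edge_ideal K G) C -> B m ->
    exists2 c, C c & (c <= m)%MM.
  move=> genB genC Bm; apply: (@mpolyX_ideal_span n K).
  rewrite (genC : ideal_span _ = _) -(genB : ideal_span _ = _).
  by apply: mem_ideal_span; exists m.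
have minE : minimal_monomial_generating_set (edge_ideal K G) (edge_monomials G).
  split=> // C sub genC; apply/seteqP; split=> // m Em.
  have [c Cc le] := dvdE _ _ _ genE genC Em.
  by rewrite -(edge_monomials_le (sub _ Cc) Em le).
apply/seteqP; split=> [m [B [genB minB] Bm]|m Em]; last first.
  by exists (edge_monomials G).
(* By minimality of [B] it is enough that [B] contains every edge monomial [e]. Some [b] in [B]
   divides [e], and some edge monomial [e'] divides [b]; then [e' = e], which forces [b = e]. *)
suff eqEB : edge_monomials G = B by rewrite eqEB.
apply: minB => // e Ee.
have [b Bb leb] := dvdE _ _ _ genE genB Ee.
have [e' Ee' lee'] := dvdE _ _ _ genB genE Bb.
have eqe : e' = e by apply: edge_monomials_le Ee' Ee (lepm_trans lee' leb).
have -> // : e = b by apply: lepm_anti; rewrite leb -{1}eqe lee'.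
Qed.

(** * Atoms of the lcm lattice and the effect of distributivity *)

Section EdgeLattice.

Variables (K : fieldType) (n : nat) (G : rel 'I_n).
Local Notation L := (lcm_lattice (edge_ideal K G)).

Lemma lcm_latticeP (x : L) : exists2 S : {fset 'X_{1..n}},
  (forall s, s \in S -> edge_monomials G s) & val x = monomial_lcm S.
Proof.
have /asboolP[S SI eqx] := valP x; exists S => // s /SI.
by rewrite minimal_monomial_generators_edge_ideal.
Qed.

Lemma lcm_lattice_exists (S : {fset 'X_{1..n}}) :
  (forall s, s \in S -> edge_monomials G s) ->
  exists x : L, val x = monomial_lcm S.
Proof.
move=> SE; have lcmS : `[< generator_lcms (edge_ideal K G) (monomial_lcm S) >].
  by apply/asboolP; exists S; rewrite ?minimal_monomial_generators_edge_ideal.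
by exists (exist (fun m => `[< generator_lcms _ m >]) _ lcmS).
Qed.

Lemma edge_lcm_lattice m : edge_monomials G m -> exists x : L, val x = m.
Proof.
move=> Em; have [|x eqx] := @lcm_lattice_exists [fset m]%fset.
  by move=> s; rewrite inE => /eqP ->.
exists x; rewrite eqx; apply: lepm_anti; apply/andP; split.
  by apply/monomial_lcm_le => s; rewrite inE => /eqP ->; exact: lepm_refl.
by apply: le_monomial_lcm; rewrite inE.
Qed.

(** The meet is an lcm of edge monomials, each dividing both [val x] and [val y]. Any such divisor
    would equal both, so the lcm is over the empty set, even when the two edges share a vertex and
    their gcd is not 1. *)
Lemma lcm_meet_edges (x y : L) :
  edge_monomials G (val x) -> edge_monomials G (val y) -> x <> y ->
  val (x `&` y)%O = 0%MM.
Proof.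
move=> Ex Ey nexy.
have [S SE eqS] := lcm_latticeP (x `&` y)%O.
have [S0|[s sS]] := fset_0Vmem S.
  by rewrite eqS S0 /monomial_lcm big_nil.
have le_s : (s <= val (x `&` y)%O)%MM by rewrite eqS le_monomial_lcm.
have lex : (val (x `&` y)%O <= val x)%MM by exact: (leIl x y).
have ley : (val (x `&` y)%O <= val y)%MM by exact: (leIr y x).
case: nexy; apply: val_inj.
rewrite -(edge_monomials_le (SE _ sS) Ex (lepm_trans le_s lex)).
exact: edge_monomials_le (SE _ sS) Ey (lepm_trans le_s ley).
Qed.

(** Otherwise the edges [i a], [i j], [j b] form a path, or a triangle if [a = b]. The middle edge
    [e] lies below the join of the outer edges [f] and [g], while its meet with each of them is 1,
    against distributivity. *)
Lemma distributive_edge_end (i j a b : 'I_n) :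
  distributive_lattice L -> irreflexive G ->
  G i j -> G i a -> G j b -> a = j \/ b = i.
Proof.
move=> distr irr Gij Gia Gjb.
have [->|neaj] := eqVneq a j; first by left.
have [->|nebi] := eqVneq b i; first by right.
have neij : i != j by apply: contraTneq Gij => ->; rewrite irr.
have neia : i != a by apply: contraTneq Gia => ->; rewrite irr.
have nejb : j != b by apply: contraTneq Gjb => ->; rewrite irr.
have Ee : edge_monomials G (U_(i) + U_(j))%MM by exists i, j.
have Ef : edge_monomials G (U_(i) + U_(a))%MM by exists i, a.
have Eg : edge_monomials G (U_(j) + U_(b))%MM by exists j, b.
have [e eqe] := edge_lcm_lattice Ee.
have [f eqf] := edge_lcm_lattice Ef.
have [g eqg] := edge_lcm_lattice Eg.
have neef : e <> f.
  move=> /(congr1 val); rewrite eqe eqf => /mnmP/(_ j).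
  by rewrite !mnmDE !mnm1E eqxx (negPf neij) (negPf neaj).
have neeg : e <> g.
  move=> /(congr1 val); rewrite eqe eqg => /mnmP/(_ i).
  by rewrite !mnmDE !mnm1E eqxx eq_sym (negPf neij) (negPf nebi).
have /meet_idPl eq_e : (e <= f `|` g)%O.
  rewrite /Order.le /= /lcm_le; apply/mnm_lepP => k.
  rewrite /= eqe eqf eqg /mlcm mnmE !mnmDE !mnm1E.
  have [<-|_] := eqVneq i k; first by rewrite [j == i]eq_sym (negPf neij) addn0 leq_max leq_addr.
  by rewrite !add0n leq_max leq_addr orbT.
have : val e = mlcm (val (e `&` f)%O) (val (e `&` g)%O).
  by rewrite -[in LHS]eq_e distr.
rewrite !lcm_meet_edges ?eqe ?eqf ?eqg // mlcm0 => /mnmP/(_ i).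
by rewrite mnmDE mnm0E mnm1E eqxx.
Qed.

End EdgeLattice.

(** * Recognizing star graphs *)

(** This removes the numbering of the vertices. The vertex [x] excludes the empty graph, which is a
    star on no vertices and has no center. *)
Lemma star_graphP (T : finType) (G : rel T) (x : T) :
  star_graph G <-> exists c, forall i j, G i j = (i == c) (+) (j == c).
Proof.
split=> [[m [f [g fK gK] isoG]]|[c GE]].
  have m_gt0 : (0 < m)%N by apply: leq_ltn_trans (ltn_ord (f x)).
  have centerE i : (val (f i) == 0%N) = (i == g (Ordinal m_gt0)).
    by rewrite -(can_eq fK) gK.
  by exists (g (Ordinal m_gt0)) => i j; rewrite -isoG /star !centerE.
have T_gt0 : (0 < #|T|)%N by apply/card_gt0P; exists x.
(* The transposition brings the rank of the center [c] to 0, as [star] demands. *)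
pose f i := tperm (enum_rank c) (Ordinal T_gt0) (enum_rank i).
have centerE i : (val (f i) == 0%N) = (i == c).
  have -> : (val (f i) == 0%N) = (f i == f c) by rewrite /f tpermL.
  by rewrite (inj_eq perm_inj) (inj_eq enum_rank_inj).
exists #|T|, f => [|i j]; last by rewrite /star !centerE GE.
exact: bij_comp (injF_bij (@perm_inj _ _)) (@enum_rank_bij T).
Qed.

Lemma star_graph_of_edge_ends (T : finType) (G : rel T) :
  ssrbool.symmetric G -> irreflexive G -> connected_graph G ->
  nontrivial_graph G ->
  (forall i j a b, G i j -> G i a -> G j b -> a = j \/ b = i) ->
  star_graph G.
Proof.
move=> sym irr conn [x0 [y0 Gxy0]] ends.
(* One end of the given edge is a leaf, taken as [y]; the other end [x] will be the center. *)
have [x [y [Gxy leaf_y]]] : exists x y, G x y /\ forall b, G y b -> b = x.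
  have [leaf|] := pselect (forall b, G y0 b -> b = x0).
    by exists x0, y0.
  move/existsNP => [b /not_implyP[Gyb neb]].
  exists y0, x0; split=> [|a Gxa]; first by rewrite sym.
  by have [|/neb] := ends _ _ _ _ Gxy0 Gxa Gyb.
(* The end condition for the edge [x v], with neighbors [y] of [x] and [w] of [v], gives [y = v] or
   [w = x]; in the first case [v] is the leaf. *)
have closed_star v w : G x v -> G v w -> w = x.
  move=> Gxv Gvw; have [eqyv|//] := ends _ _ _ _ Gxv Gxy Gvw.
  by apply: leaf_y; rewrite eqyv.
(* Induction along a path from [x]: a step leaving a neighbor of [x] can only return to [x]. *)
have adj_x v : v != x -> G x v.
  have /connectP[p] := conn x v.
  elim/last_ind: p v => [|p w IHp] v /=; first by move=> _ ->; rewrite eqxx.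
  rewrite rcons_path last_rcons => /andP[px Gpw] -> new.
  have [eqx|nex] := eqVneq (last x p) x; first by rewrite -{1}eqx.
  have := closed_star _ _ (IHp _ px erefl nex) Gpw.
  by move/eqP; rewrite (negPf new).
apply/(star_graphP G x); exists x => i j.
have [-> /=|nei] := eqVneq i x.
  by have [->|/adj_x ->] := eqVneq j x; first by rewrite irr.
have [->|nej] /= := eqVneq j x; first by rewrite sym adj_x.
apply/negbTE/negP => Gij.
by move/eqP: nej; apply; apply: closed_star Gij; apply: adj_x.
Qed.

(** * Lattices isomorphic to a powerset *)

Section PowersetLattice.

Import mathcomp.boot.fintype mathcomp.boot.finset.

(** An order embedding onto the subsets of [D] carries meets and joins to intersections and unions,
    since these are determined by the order. Complements are then complements in [D]. *)
Lemma boolean_lattice_powerset d (L : latticeType d) (T : finType)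
    (D : {set T}) (phi : L -> {set T}) :
  (forall x y, (x <= y)%O = (phi x \subset phi y)) ->
  (forall x, phi x \subset D) ->
  (forall A : {set T}, A \subset D -> exists x, phi x = A) ->
  boolean_lattice L.
Proof.
move=> le_phi phiD phi_onto.
have phi_inj : injective phi.
  by move=> x y eq_phi; apply/le_anti; rewrite !le_phi eq_phi subxx.
have phiI x y : phi (x `&` y)%O = phi x :&: phi y.
  apply/eqP; rewrite eqEsubset subsetI -!le_phi leIl leIr /=.
  have [|z eqz] := phi_onto (phi x :&: phi y).
    exact: subset_trans (subsetIl _ _) (phiD x).
  by rewrite -eqz -le_phi lexI !le_phi eqz subsetIl subsetIr.
have phiU x y : phi (x `|` y)%O = phi x :|: phi y.
  apply/eqP; rewrite eqEsubset subUset -!le_phi leUl leUr /= andbT.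
  have [|z eqz] := phi_onto (phi x :|: phi y).
    by rewrite subUset !phiD.
  by rewrite -eqz -le_phi leUx !le_phi eqz subsetUl subsetUr.
have [b phib] := phi_onto _ (sub0set D).
have [t phit] := phi_onto _ (subxx D).
exists b, t; split=> [x|x y z|x].
- by rewrite !le_phi phib phit sub0set phiD.
- by apply: phi_inj; rewrite !(phiI, phiU) setIUr.
have [y phiy] := phi_onto _ (subsetDl D (phi x)).
exists y; split=> [|z [/(congr1 phi) + /(congr1 phi)]].
  split; apply: phi_inj; rewrite (phiI, phiU) phiy (phib, phit).
    by rewrite setIDA setIC -setIDA setDv setI0.
  by rewrite -{1}(setIidPr (phiD x)) setID.
(* Uniqueness: removing [phi x] from [D], the disjoint union of [phi x] and [phi z], leaves
   [phi z]. *)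
rewrite phiI phiU phib phit => Ixz Uxz; apply: phi_inj.
rewrite phiy -Uxz setDUl setDv set0U.
by apply/setDidPl; rewrite -setI_eq0 setIC Ixz.
Qed.

End PowersetLattice.

(** * The lcm lattice of a star, and the equivalence *)

Lemma boolean_star_lcm_lattice (K : fieldType) n (G : rel 'I_n) (c : 'I_n) :
  (forall i j, G i j = (i == c) (+) (j == c)) ->
  boolean_lattice (lcm_lattice (edge_ideal K G)).
Proof.
move=> GE; pose e j : 'X_{1..n} := (U_(c) + U_(j))%MM.
have edgeE m : edge_monomials G m <-> exists2 j, j != c & m = e j.
  split=> [[i [j [+ ->]]]|[j nej ->]]; last first.
    by exists c, j; rewrite GE eqxx (negPf nej).
  rewrite GE; have [->|nei] := eqVneq i c; first by exists j.
  by move=> /= /eqP ->; exists i => //; rewrite addmC.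
pose phi (x : lcm_lattice (edge_ideal K G)) :=
  [set j | (j != c) && (e j <= val x)%MM]%SET.
apply: (@boolean_lattice_powerset _ _ _ [set~ c]%SET phi) => [x y|x|A sAD].
(* [phi] reflects the order because each element is the lcm of edge monomials, all of the form [e j]
   with [j] a leaf. *)
- apply/idP/fintype.subsetP => [lexy j|sub].
    rewrite !inE => /andP[-> le]; exact: lepm_trans le lexy.
  have [S SE eqx] := lcm_latticeP x.
  rewrite /Order.le /= /lcm_le eqx; apply/monomial_lcm_le => s sS.
  have /edgeE[j nej eqs] := SE s sS.
  have : j \in phi x by rewrite inE nej -eqs eqx le_monomial_lcm.
  by move/sub; rewrite inE -eqs => /andP[].
- by apply/fintype.subsetP => j; rewrite !inE => /andP[].
have neA j : j \in A -> j != c by move/(fintype.subsetP sAD); rewrite !inE.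
have [|x eqx] := @lcm_lattice_exists K n G [fset e j | j in A]%fset.
  by move=> s /imfsetP[j /= /neA nej ->]; apply/edgeE; exists j.
exists x; apply/finset.setP => j; rewrite inE eqx.
apply/andP/idP => [[nej le]|jA]; last first.
  by split; [exact: neA | apply/le_monomial_lcm/imfsetP; exists j].
apply: contraTT le => njA; apply/negP => le.
(* The bound is the variable of [c] times the product of all variables except that of [j]. Every
   [e k] with [k] in [A] divides it, hence so does their lcm, but [e j] does not. *)
have /mnm_lepP/(_ j) : (e j <= [multinom (i != j : nat) + (i == c) | i < n])%MM.
  apply: lepm_trans le _; apply/monomial_lcm_le => _ /imfsetP[k /= kA ->].
  apply/mnm_lepP => i; rewrite mnmDE mnmE !mnm1E.
  rewrite addnC [c == i]eq_sym leq_add2r.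
  have [<-|//] := eqVneq k i.
  by have -> : k != j by apply: contraNneq njA => <-.
by rewrite mnmDE !mnm1E mnmE eqxx eq_sym (negPf nej).
Qed.

Theorem corollary6p4 (K : fieldType) (n : nat) (G : rel 'I_n)
  (G_sym : ssrbool.symmetric G) (G_irr : irreflexive G)
  (G_conn : connected_graph G) (G_nontriv : nontrivial_graph G) :
  [<-> boolean_lattice (lcm_lattice (edge_ideal K G));
       distributive_lattice (lcm_lattice (edge_ideal K G));
       star_graph G].
Proof.
tfae=> [[b [t []]] //|distr|].
  apply: star_graph_of_edge_ends => // i j a b.
  exact: distributive_edge_end distr G_irr.
have [x _] := G_nontriv.
by case/(star_graphP G x) => c; exact: boolean_star_lcm_lattice.
Qed.
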